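(* Let $\widetilde K_{\star,\mathcal S}\in\widetilde{\mathcal K}_{\mathrm{stab},\mathcal S}$ be a minimizer of the multitask empirical cost $\hat J(\widetilde K)=\frac1N\sum_{i=1}^NJ^{(i)}(\widetilde K)$ over $\widetilde{\mathcal K}_{\mathcal S}$. Then, for every task $\mathcal T^{(i)}$ in the training set $\mathcal S$, $$J^{(i)}(\widetilde K_{\star,\mathcal S})-J^{(i)}(\widetilde K_\star^{(i)})\le\frac{\|S_\star^{(i)}\|\,\|\Sigma_{\widetilde K_\star^{(i)}}^{(i)}\|\,b_i(\widetilde K_{\star,\mathcal S})}{4\lambda_{\min}(\Sigma_\nu^{(i)})^2\lambda_{\min}(R^{(i)})}.$$
   Context: $\|\cdot\|$ is the spectral norm, $\|\cdot\|_F$ the Frobenius norm. **Tasks.** An LQG task is a tuple $\mathcal T^{(i)}=(A^{(i)},B^{(i)},C^{(i)},W^{(i)},V^{(i)},Q^{(i)},R^{(i)})$ defining $x_{t+1}^{(i)}=A^{(i)}x_t^{(i)}+B^{(i)}u_t^{(i)}+w_t^{(i)}$, $y_t^{(i)}=C^{(i)}x_t^{(i)}+v_t^{(i)}$, $x_0^{(i)}=0$, with state in $\mathbb R^{n_x}$, input in $\mathbb R^{n_u}$, output in $\mathbb R^{n_y}$; the noises $w_t^{(i)}\sim\mathcal N(0,W^{(i)})$, $v_t^{(i)}\sim\mathcal N(0,V^{(i)})$ are i.i.d. in time, mutually independent, independent across tasks, $W^{(i)}\succeq0$, $V^{(i)}\succ0$; $Q^{(i)}\succeq0$, $R^{(i)}\succ0$.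 Each $(A^{(i)},B^{(i)})$ is controllable and $(A^{(i)},C^{(i)})$ observable. The cost is $J^{(i)}=\limsup_{T\to\infty}\frac1T\mathbb E\sum_{t=0}^{T-1}(y_t^{(i)\top}Q^{(i)}y_t^{(i)}+u_t^{(i)\top}R^{(i)}u_t^{(i)})$. The training set is $\mathcal S=\{\mathcal T^{(i)}\}_{i=1}^N$. **Lifted controllers.** Fix a history length $p\in\mathbb N$ and let $z_{t,p}^{(i)}\in\mathbb R^{p(n_u+n_y)}$ stack $u_{t-1}^{(i)},\dots,u_{t-p}^{(i)},y_t^{(i)},\dots,y_{t-p+1}^{(i)}$. $S_\star^{(i)}\in\mathbb R^{n_x\times p(n_u+n_y)}$ is a fixed task-dependent matrix (determined by the task parameters, the Kalman gain and the optimal LQG gain) with $\widehat x_t^{(i)}=S_\star^{(i)}z_{t,p}^{(i)}$, where $\widehat x_t^{(i)}$ is the Kalman filter state estimate; $\dagger$ denotes the pseudoinverse. A lifted controller $\widetilde K\in\mathbb R^{n_u\times p(n_u+n_y)}$ defines the policy $u_t^{(i)}=\widetilde Kz_{t,p}^{(i)}$, corresponding to the gain $K=\widetilde KS_\star^{(i)\dagger}$ on the estimate; $J^{(i)}(\widetilde K)$ is the resulting cost. Let $A_{\widetilde K}^{(i)}:=A^{(i)}+B^{(i)}\widetilde KS_\star^{(i)\dagger}$, $\widetilde{\mathcal K}^{(i)}:=\{\widetilde K:\rho(A_{\widetilde K}^{(i)})<1\}$, $\widetilde{\mathcal K}_{\mathcal S}:=\bigcap_{i=1}^N\widetilde{\mathcal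 K}^{(i)}$, and let $\widetilde K_\star^{(i)}$ minimize $J^{(i)}$ over $\widetilde{\mathcal K}^{(i)}$ (the optimal lifted controller of task $i$). Given $\widetilde K_0\in\widetilde{\mathcal K}_{\mathcal S}$ and constants $\beta_1,\dots,\beta_N\ge1$, set $\widetilde{\mathcal K}_{\mathrm{stab}}^{(i)}:=\{\widetilde K\in\widetilde{\mathcal K}^{(i)}:J^{(i)}(\widetilde K)-J^{(i)}(\widetilde K_\star^{(i)})\le\beta_i(J^{(i)}(\widetilde K_0)-J^{(i)}(\widetilde K_\star^{(i)}))\}$ and $\widetilde{\mathcal K}_{\mathrm{stab},\mathcal S}:=\bigcap_{i=1}^N\widetilde{\mathcal K}_{\mathrm{stab}}^{(i)}$. **Gradient.** $\mathtt{dare}(A,B,Q,R)$ is the unique stabilizing solution $P$ of $P=Q+A^\top PA-A^\top PB(R+B^\top PB)^{-1}B^\top PA$. Let $\widetilde\Sigma^{(i)}=\mathtt{dare}(A^{(i)\top},C^{(i)\top},W^{(i)},V^{(i)})$, $L^{(i)}=\widetilde\Sigma^{(i)}C^{(i)\top}(C^{(i)}\widetilde\Sigma^{(i)}C^{(i)\top}+V^{(i)})^{-1}$, $\Sigma_\nu^{(i)}=L^{(i)}(C^{(i)}\widetilde\Sigma^{(i)}C^{(i)\top}+V^{(i)})L^{(i)\top}$, $\widetilde Q^{(i)}=C^{(i)\top}Q^{(i)}C^{(i)}$. For $\widetilde K\in\widetilde{\mathcal K}^{(i)}$, $P_{\widetilde K}^{(i)}$ and $\Sigma_{\widetilde K}^{(i)}$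 are the unique solutions of $P=\widetilde Q^{(i)}+S_\star^{(i)\dagger\top}\widetilde K^\top R^{(i)}\widetilde KS_\star^{(i)\dagger}+A_{\widetilde K}^{(i)\top}PA_{\widetilde K}^{(i)}$ and $\Sigma=\Sigma_\nu^{(i)}+A_{\widetilde K}^{(i)}\Sigma A_{\widetilde K}^{(i)\top}$. Put $E_{\widetilde K}^{(i)}:=2\big((R^{(i)}+B^{(i)\top}P_{\widetilde K}^{(i)}B^{(i)})\widetilde KS_\star^{(i)\dagger}+B^{(i)\top}P_{\widetilde K}^{(i)}A^{(i)}\big)$. The gradient is $\nabla J^{(i)}(\widetilde K)=E_{\widetilde K}^{(i)}\Sigma_{\widetilde K}^{(i)}S_\star^{(i)\dagger\top}$. **Standing property (stated by the paper as standard): gradient dominance.** For $\widetilde K\in\widetilde{\mathcal K}_{\mathrm{stab}}^{(i)}$, $J^{(i)}(\widetilde K)-J^{(i)}(\widetilde K_\star^{(i)})\le\frac1{\gamma_i}\|\nabla J^{(i)}(\widetilde K)\|_F^2$ with $\gamma_i:=4\lambda_{\min}(\Sigma_\nu^{(i)})^2\lambda_{\min}(R^{(i)})/(\|\Sigma_{\widetilde K_\star^{(i)}}^{(i)}\|\|S_\star^{(i)}\|)$ (implicitly $\gamma_i>0$). **Bisimulation-based heterogeneity.** Let $F_{\widetilde K}^{(i)}=A_{\widetilde K}^{(i)}\otimes A_{\widetilde K}^{(i)}$, $C_{\widetilde K}^{(i)}=S_\star^{(i)\dagger}\otimes E_{\widetilde K}^{(i)}$, $\nu^{(i)}=\mathrm{vec}(\Sigma_\nu^{(i)})$,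 $F_{\widetilde K}^{(ij)}=\mathrm{diag}(F_{\widetilde K}^{(i)},F_{\widetilde K}^{(j)})$ (block diagonal), $C_{\widetilde K}^{(ij)}=[C_{\widetilde K}^{(i)}\;-C_{\widetilde K}^{(j)}]$, $\nu^{(ij)}=[\nu^{(i)\top}\;\nu^{(j)\top}]^\top$. For $\widetilde K\in\widetilde{\mathcal K}_{\mathrm{stab},\mathcal S}$ and $i\neq j$, let $M_{\widetilde K}^{(ij)}\in\mathbb S_+^{2n_x^2}$ and $\lambda_{\widetilde K}^{(ij)}\in(0,1)$ denote the minimizers of $\frac{(1+\eta^{-1})\,\nu^{(ij)\top}M\nu^{(ij)}}{\lambda-\eta(1-\lambda)}$ (with the optimal choice $\eta=\frac1{\sqrt{1-\lambda}}-1\in(0,\frac{\lambda}{1-\lambda})$) subject to $M\succeq C_{\widetilde K}^{(ij)\top}C_{\widetilde K}^{(ij)}$ and $F_{\widetilde K}^{(ij)\top}MF_{\widetilde K}^{(ij)}-M\preceq-\lambda M$. With $\eta_{\widetilde K}^{(ij)}:=\frac1{\sqrt{1-\lambda_{\widetilde K}^{(ij)}}}-1$, define $$b_{ij}(\widetilde K):=\frac{\big(1+(\eta_{\widetilde K}^{(ij)})^{-1}\big)\nu^{(ij)\top}M_{\widetilde K}^{(ij)}\nu^{(ij)}}{\lambda_{\widetilde K}^{(ij)}-\eta_{\widetilde K}^{(ij)}(1-\lambda_{\widetilde K}^{(ij)})},\qquad b_i(\widetilde K):=\frac1{N-1}\sum_{j\ne i}b_{ij}(\widetilde K).$$ *)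

(* Defs.v *)
From HB Require Import structures.
From mathcomp Require Import all_boot all_order all_algebra.
From mathcomp Require Import complex mxtens.
From mathcomp Require Import all_classical all_reals all_analysis.
Import Order.TTheory GRing.Theory Num.Theory.
Import numFieldNormedType.Exports.

Set Implicit Arguments.
Unset Strict Implicit.
Unset Printing Implicit Defensive.

Local Open Scope classical_set_scope.
Local Open Scope ring_scope.

Section MatrixNotions.
Context {R : realType}.

Definition quad n (M : 'M[R]_n) (x : 'cV[R]_n) : R := (x^T *m M *m x) 0 0.

Definition psd n (M : 'M[R]_n) : Prop :=
  M^T = M /\ forall x : 'cV[R]_n, 0 <= quad M x.

Definition posdef n (M : 'M[R]_n) : Prop :=
  M^T = M /\ forall x : 'cV[R]_n, x != 0 -> 0 < quad M x.

Definition loewner_le n (M1 M2 : 'M[R]_n) : Prop := psd (M2 - M1).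

Definition norm2 n (x : 'cV[R]_n) : R := Num.sqrt (\sum_i x i 0 ^+ 2).

Definition spectral_norm m n (M : 'M[R]_(m, n)) : R :=
  sup [set norm2 (M *m x) | x in [set x : 'cV[R]_n | norm2 x <= 1]].

Definition frobenius_norm m n (M : 'M[R]_(m, n)) : R :=
  Num.sqrt (\sum_i \sum_j M i j ^+ 2).

(* The eigenvalues of [M] are taken over the complex numbers [R[i]];
   [complex.Re `|z|] is the modulus of [z] as a real number. *)
Definition spectral_radius n (M : 'M[R]_n) : R :=
  sup [set complex.Re `|z| | z in
        [set z : R[i] | eigenvalue (map_mx (real_complex R) M) z]].

(* Used for symmetric [M] only, whose eigenvalues are all real. *)
Definition lambda_min n (M : 'M[R]_n) : R :=
  inf [set a : R | eigenvalue M a].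

Definition is_pinv m n (M : 'M[R]_(m, n)) (X : 'M[R]_(n, m)) : Prop :=
  [/\ M *m X *m M = M, X *m M *m X = X,
      (M *m X)^T = M *m X & (X *m M)^T = X *m M].

Definition pinv m n (M : 'M[R]_(m, n)) : 'M[R]_(n, m) :=
  xget 0 [set X | is_pinv M X].

(* Column-stacking; the index convention is that of [tensmx], so that
   [vec (M1 *m X *m M2^T) = tensmx M2 M1 *m vec X]. *)
Definition vec m n (M : 'M[R]_(m, n)) : 'cV[R]_(n * m) :=
  \col_k M (mxtens_unindex k).2 (mxtens_unindex k).1.

Definition controllable n m (A : 'M[R]_n) (B : 'M[R]_(n, m)) : Prop :=
  \rank (\mxrow_(k < n) (A ^+ k *m B)) = n.

Definition observable n m (A : 'M[R]_n) (C : 'M[R]_(m, n)) : Prop :=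
  controllable A^T C^T.

Definition dare_gain n m (A : 'M[R]_n) (B : 'M[R]_(n, m)) (S : 'M[R]_m)
    (X : 'M[R]_n) : 'M[R]_(m, n) :=
  invmx (S + B^T *m X *m B) *m B^T *m X *m A.

Definition is_stabilizing_dare n m (A : 'M[R]_n) (B : 'M[R]_(n, m))
    (Q : 'M[R]_n) (S : 'M[R]_m) (X : 'M[R]_n) : Prop :=
  [/\ X^T = X,
      S + B^T *m X *m B \in unitmx,
      X = Q + A^T *m X *m A - A^T *m X *m B *m dare_gain A B S X
    & spectral_radius (A - B *m dare_gain A B S X) < 1].

Definition dare n m (A : 'M[R]_n) (B : 'M[R]_(n, m))
    (Q : 'M[R]_n) (S : 'M[R]_m) : 'M[R]_n :=
  xget 0 [set X | is_stabilizing_dare A B Q S X].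

Definition dlyap n (A W : 'M[R]_n) : 'M[R]_n :=
  xget 0 [set X | X = W + A *m X *m A^T].

End MatrixNotions.

Section Probability.
Context {R : realType} {d : measure_display} {T : measurableType d}.

(* [s] is the variance. [normal_prob] takes the standard deviation, and is not
   a Dirac mass when it is 0. *)
Definition centered_normal (s : R) (B : set R) : \bar R :=
  if s == 0 then \d_(0 : R) B else normal_prob 0 (Num.sqrt s) B.

(* All linear functionals are normal, which covers singular covariances. *)
Definition gaussian_vector (P : probability T R) n (X : T -> 'cV[R]_n)
    (W : 'M[R]_n) : Prop :=
  (forall i, measurable_fun setT (fun om => X om i 0)) /\
  forall (a : 'cV[R]_n) (B : set R), measurable B ->
    P ((fun om => (a^T *m X om) 0 0) @^-1` B) = centered_normal (quad W a) B.

Definition sigma_of n (X : T -> 'cV[R]_n) : set (set T) :=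
  <<s [set E | exists (i : 'I_n) (B : set R),
         measurable B /\ E = (fun om => X om i 0) @^-1` B] >>.

Definition mutually_independent (P : probability T R) (I : choiceType)
    (F : I -> set (set T)) : Prop :=
  forall (s : seq I) (E : I -> set T), uniq s ->
    (forall k, k \in s -> F k (E k)) ->
    P (\bigcap_(k in [set` s]) E k) = (\prod_(k <- s) P (E k))%E.

End Probability.

Record lqg_task (R : realType) (nx nu ny : nat) := LqgTask {
  lqgA : 'M[R]_nx;
  lqgB : 'M[R]_(nx, nu);
  lqgC : 'M[R]_(ny, nx);
  lqgW : 'M[R]_nx;
  lqgV : 'M[R]_ny;
  lqgQ : 'M[R]_ny;
  lqgR : 'M[R]_nu }.

Definition wf_task (R : realType) nx nu ny (tk : lqg_task R nx nu ny) : Prop :=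
  [/\ psd (lqgW tk), posdef (lqgV tk), psd (lqgQ tk) & posdef (lqgR tk)] /\
  controllable (lqgA tk) (lqgB tk) /\ observable (lqgA tk) (lqgC tk).

Section Noise.
Context {R : realType} {d : measure_display} {T : measurableType d}.
Context {nx nu ny N : nat}.

Definition noise_sigma (w : 'I_N -> nat -> T -> 'cV[R]_nx)
    (v : 'I_N -> nat -> T -> 'cV[R]_ny)
    (k : ('I_N * nat) + ('I_N * nat)) : set (set T) :=
  match k with
  | inl it => sigma_of (w it.1 it.2)
  | inr it => sigma_of (v it.1 it.2)
  end.

Definition lqg_noise (P : probability T R) (tk : 'I_N -> lqg_task R nx nu ny)
    (w : 'I_N -> nat -> T -> 'cV[R]_nx) (v : 'I_N -> nat -> T -> 'cV[R]_ny)
    : Prop :=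
  [/\ forall i t, gaussian_vector P (w i t) (lqgW (tk i)),
      forall i t, gaussian_vector P (v i t) (lqgV (tk i))
    & mutually_independent P (noise_sigma w v)].

End Noise.

Section Kalman.
Context {R : realType} {nx nu ny : nat} (tk : lqg_task R nx nu ny).
Local Notation A := (lqgA tk).
Local Notation B := (lqgB tk).
Local Notation C := (lqgC tk).

Definition kalman_cov : 'M[R]_nx := dare A^T C^T (lqgW tk) (lqgV tk).

Definition innovation_cov : 'M[R]_ny := C *m kalman_cov *m C^T + lqgV tk.

Definition kalman_gain : 'M[R]_(nx, ny) :=
  kalman_cov *m C^T *m invmx innovation_cov.

Definition Sigma_nu : 'M[R]_nx :=
  kalman_gain *m innovation_cov *m kalman_gain^T.

Definition Qtilde : 'M[R]_nx := C^T *m lqgQ tk *m C.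

(* Closed loop of the gain [K] on the Kalman estimate, along one realization
   [w], [v] of the noises. [kalman_update xp y] corrects the prediction [xp] by
   the measurement [y]; the initial prediction is x_0 = 0. *)
Section ClosedLoop.
Context (K : 'M[R]_(nu, nx)) (w : nat -> 'cV[R]_nx) (v : nat -> 'cV[R]_ny).

Definition kalman_update (xp : 'cV[R]_nx) (y : 'cV[R]_ny) : 'cV[R]_nx :=
  xp + kalman_gain *m (y - C *m xp).

Fixpoint loop (t : nat) : 'cV[R]_nx * 'cV[R]_nx :=
  match t with
  | 0%N => (0, kalman_update 0 (C *m 0 + v 0))
  | t'.+1 =>
      let: (x, xh) := loop t' in
      let u := K *m xh in
      let x' := A *m x + B *m u + w t' in
      (x', kalman_update (A *m xh + B *m u) (C *m x' + v t'.+1))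
  end.

Definition state t : 'cV[R]_nx := (loop t).1.
Definition estimate t : 'cV[R]_nx := (loop t).2.
Definition input t : 'cV[R]_nu := K *m estimate t.
Definition output t : 'cV[R]_ny := C *m state t + v t.

(* [mxvec] concatenates rows: row [k] of the two matrices is u_(t-1-k) and
   y_(t-k). Signals vanish at negative times. *)
Definition history (p t : nat) : 'cV[R]_(p * nu + p * ny) :=
  (row_mx
    (mxvec (\matrix_(k < p, a < nu)
       if (k < t)%N then input (t - k.+1) a 0 else 0))
    (mxvec (\matrix_(k < p, a < ny)
       if (k <= t)%N then output (t - k) a 0 else 0)))^T.

End ClosedLoop.

Context {d : measure_display} {T : measurableType d} (P : probability T R).
Context (w : nat -> T -> 'cV[R]_nx) (v : nat -> T -> 'cV[R]_ny).

(* The value is real-valued by [fine]; the limsup is finite on the gains [K]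
   with [spectral_radius (A + B *m K) < 1], an open set outside which the cost
   is never used. *)
Definition gain_cost (K : 'M[R]_(nu, nx)) : R :=
  fine (limn_esup (fun n : nat =>
    (n%:R^-1)%R%:E * 'E_P[fun om => (\sum_(t < n)
      (quad (lqgQ tk) (output K (w^~ om) (v^~ om) t) +
       quad (lqgR tk) (input K (w^~ om) (v^~ om) t)))%R])%E).

End Kalman.

Section Lifted.
Context {R : realType} {nx nu ny p : nat} (tk : lqg_task R nx nu ny).
Context (S : 'M[R]_(nx, p * nu + p * ny)).
Local Notation A := (lqgA tk).
Local Notation B := (lqgB tk).
Local Notation lifted := 'M[R]_(nu, p * nu + p * ny).

Definition gain_of (K : lifted) : 'M[R]_(nu, nx) := K *m pinv S.

Definition A_cl (K : lifted) : 'M[R]_nx := A + B *m gain_of K.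

Definition stable_set : set lifted := [set K | spectral_radius (A_cl K) < 1].

Definition P_K (K : lifted) : 'M[R]_nx :=
  dlyap (A_cl K)^T (Qtilde tk + (gain_of K)^T *m lqgR tk *m gain_of K).

Definition Sigma_K (K : lifted) : 'M[R]_nx := dlyap (A_cl K) (Sigma_nu tk).

Definition E_K (K : lifted) : 'M[R]_(nu, nx) :=
  2 *: ((lqgR tk + B^T *m P_K K *m B) *m gain_of K + B^T *m P_K K *m A).

Definition grad_formula (K : lifted) : lifted :=
  E_K K *m Sigma_K K *m (pinv S)^T.

Definition F_K (K : lifted) : 'M[R]_(nx * nx) := tensmx (A_cl K) (A_cl K).

Definition C_K (K : lifted) : 'M[R]_((p * nu + p * ny) * nu, nx * nx) :=
  tensmx (pinv S) (E_K K).

Definition nu_vec : 'cV[R]_(nx * nx) := vec (Sigma_nu tk).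

Definition gamma (Kopt : lifted) : R :=
  4 * lambda_min (Sigma_nu tk) ^+ 2 * lambda_min (lqgR tk) /
  (spectral_norm (Sigma_K Kopt) * spectral_norm S).

Context {d : measure_display} {T : measurableType d} (P : probability T R).
Context (w : nat -> T -> 'cV[R]_nx) (v : nat -> T -> 'cV[R]_ny).

(* A lifted controller [K] is run through its gain K S^+ on the estimate: where
   xhat_t = S z_t, the input is [K] applied to S^+ S z_t, the component of the
   history z_t that S retains. The stability set, [P_K], [Sigma_K] and
   [grad_formula] are all those of this loop. For u_t = K z_t they would not be:
   components of [K] that S^+ annihilates would then change the cost, whereas
   [grad_formula] is blind to them. *)
Definition cost (K : lifted) : R := gain_cost tk P w v (gain_of K).

Definition stab_sublevel (Kopt K0 : lifted) (beta : R) : set lifted :=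
  [set K | stable_set K /\
           cost K - cost Kopt <= beta * (cost K0 - cost Kopt)].

End Lifted.

Section Bisimulation.
Context {R : realType}.

Definition eta_of (lam : R) : R := (Num.sqrt (1 - lam))^-1 - 1.

Definition bisim_obj n (nu : 'cV[R]_n) (M : 'M[R]_n) (lam : R) : R :=
  (1 + (eta_of lam)^-1) * quad M nu / (lam - eta_of lam * (1 - lam)).

Definition bisim_feasible n q (F : 'M[R]_n) (C : 'M[R]_(q, n))
    (M : 'M[R]_n) (lam : R) : Prop :=
  [/\ psd M, 0 < lam < 1, loewner_le (C^T *m C) M
    & loewner_le (F^T *m M *m F - M) (- (lam *: M))].

Definition bisim_minimizer n q (F : 'M[R]_n) (C : 'M[R]_(q, n))
    (nu : 'cV[R]_n) (M : 'M[R]_n) (lam : R) : Prop :=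
  bisim_feasible F C M lam /\
  forall M' lam', bisim_feasible F C M' lam' ->
    bisim_obj nu M lam <= bisim_obj nu M' lam'.

End Bisimulation.

Section Heterogeneity.
Context {R : realType} {nx nu ny p N : nat}.
Context (tk : 'I_N -> lqg_task R nx nu ny).
Context (S : 'I_N -> 'M[R]_(nx, p * nu + p * ny)).
Local Notation lifted := 'M[R]_(nu, p * nu + p * ny).

Definition F_pair (i j : 'I_N) (K : lifted) : 'M[R]_(nx * nx + nx * nx) :=
  block_mx (F_K (tk i) (S i) K) 0 0 (F_K (tk j) (S j) K).

Definition C_pair (i j : 'I_N) (K : lifted) :
    'M[R]_((p * nu + p * ny) * nu, nx * nx + nx * nx) :=
  row_mx (C_K (tk i) (S i) K) (- C_K (tk j) (S j) K).

Definition nu_pair (i j : 'I_N) : 'cV[R]_(nx * nx + nx * nx) :=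
  col_mx (nu_vec (tk i)) (nu_vec (tk j)).

Context (M : 'I_N -> 'I_N -> lifted -> 'M[R]_(nx * nx + nx * nx)).
Context (lam : 'I_N -> 'I_N -> lifted -> R).

Definition b_pair (i j : 'I_N) (K : lifted) : R :=
  bisim_obj (nu_pair i j) (M i j K) (lam i j K).

Definition b_task (i : 'I_N) (K : lifted) : R :=
  (N%:R - 1)^-1 * \sum_(j | j != i) b_pair i j K.

End Heterogeneity.

(* Main.v *)
Require Import Defs.
From mathcomp Require Import all_boot all_order all_algebra.
From mathcomp Require Import complex mxtens.
From mathcomp Require Import all_classical all_reals all_analysis.
From mathcomp Require Import ring lra.
Import Order.TTheory GRing.Theory Num.Theory.
Import numFieldNormedType.Exports.

Set Implicit Arguments.
Unset Strict Implicit.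
Unset Printing Implicit Defensive.

Local Open Scope classical_set_scope.
Local Open Scope ring_scope.

(** Gradient dominance reduces the claim to [|grad J_i|_F^2 <= b_i] at the
    minimizer [Kst]. The stability sets are open, so [Kst] is a critical point
    and the task gradients [G_j] sum to zero; expanding the squares gives
    [(N - 1) |G_i|^2 <= \sum_(j != i) |G_i - G_j|^2]. After vectorization,
    [G_i - G_j] is [C x], where [x] stacks the vectorized covariances and solves
    [x = nu + F x]. Young's inequality with parameter [eta], applied to the
    quadratic form of the bisimulation certificate [M], bounds [|C x|^2] by
    [b_ij]; no series expansion of [x] is needed. *)

(** * Eigenvalues forced by the equation [A *m X *m B = X] *)

Section SteinEquation.
Context {F : closedFieldType}.

Lemma nonzero_row m n (X : 'M[F]_(m, n)) : X != 0 -> exists i, row i X != 0.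
Proof.
move=> /matrix0Pn[i [j Xij]]; exists i.
by apply/rV0Pn; exists j; rewrite mxE.
Qed.

Lemma eigenvalue_trmx n (A : 'M[F]_n) z : eigenvalue A^T z = eigenvalue A z.
Proof.
rewrite !eigenvalue_root_char /char_poly /char_poly_mx.
by rewrite -(det_tr ('X%:M - map_mx polyC A)) linearB /= tr_scalar_mx map_trmx.
Qed.

(* The solutions of [A *m X *m B = X] are stable under right multiplication by
   [B], so applying the factors of [char_poly B] one by one meets one with
   [X *m B = z *: X]. *)
Lemma stein_eigenvector n (A B X : 'M[F]_n) : X != 0 -> A *m X *m B = X ->
  exists z Y, [/\ Y != 0, A *m Y *m B = Y & Y *m B = z *: Y].
Proof.
case: n A B X => [|n] A B X; first by rewrite flatmx0 eqxx.
have [s Bs] := closed_field_poly_normal (char_poly B).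
have : X *m horner_mx B (\prod_(z <- s) ('X - z%:P)) = 0.
  have := Cayley_Hamilton B.
  rewrite {1}Bs (monicP (char_poly_monic B)) scale1r => ->; exact: mulmx0.
elim: s {Bs} X => [|z s IH] X.
  by rewrite big_nil rmorph1 mulmx1 => ->; rewrite eqxx.
rewrite big_cons rmorphM /= -mulmxE mulmxA rmorphB /= horner_mx_X horner_mx_C.
have [XB0 _|XB0 /IH{}IH] := eqVneq (X *m (B - z%:M)) 0.
  move=> X0 AXB; exists z, X; split => //.
  by apply/eqP; rewrite -subr_eq0 -mul_mx_scalar -mulmxBr XB0.
move=> _ AXB; apply: IH XB0 _.
by rewrite !mulmxBr mulmxBl !mul_mx_scalar -!scalemxAr -scalemxAl !mulmxA AXB.
Qed.

(** The rows of [Y] give eigenvectors for [z], while [z *: (A *m Y) = Y] makes its columns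
    eigenvectors for [z^-1]. *)
Lemma stein_eigenvalue n (A X : 'M[F]_n) : X != 0 -> A *m X *m A^T = X ->
  exists z, [/\ z != 0, eigenvalue A z & eigenvalue A z^-1].
Proof.
move=> X0 /stein_eigenvector-/(_ X0)[z [Y [Y0 AYA YA]]].
have AY : z *: (A *m Y) = Y by rewrite scalemxAr -YA mulmxA.
have z0 : z != 0 by apply: contraNneq Y0 => z0; rewrite -AY z0 scale0r.
exists z; split => //.
  have [i Yi] := nonzero_row Y0; rewrite -eigenvalue_trmx.
  by apply/eigenvalueP; exists (row i Y); rewrite // -row_mul YA linearZ.
have /nonzero_row[i Yi] : Y^T != 0 by rewrite -trmx0 (inj_eq trmx_inj).
rewrite -eigenvalue_trmx; apply/eigenvalueP; exists (row i Y^T) => //.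
rewrite -row_mul -trmx_mul -linearZ /= -linearZ /=; congr (row i (_ ^T)).
by rewrite -[in RHS]AY scalerA mulVf // scale1r.
Qed.

End SteinEquation.

(** * Openness of the condition that the spectral radius is below 1 *)

Section SpectralRadius.
Context {R : realType}.
Local Notation toC := (real_complex R).

Lemma Re_normK (z : R[i]) : toC (complex.Re `|z|) = `|z|.
Proof. by rewrite normc_def. Qed.

Lemma eigenvalue_seq n (M : 'M[R]_n) : exists s : seq R[i],
  char_poly (map_mx toC M) = \prod_(z <- s) ('X - z%:P) /\
  forall z, eigenvalue (map_mx toC M) z = (z \in s).
Proof.
have [s Ms] := closed_field_poly_normal (char_poly (map_mx toC M)).
rewrite (monicP (char_poly_monic _)) scale1r in Ms.
by exists s; split=> // z; rewrite eigenvalue_root_char Ms root_prod_XsubC.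
Qed.

(** The eigenvalues form a finite list, so a strict bound on each of them passes to the supremum. *)
Lemma spectral_radius_lt1P n (M : 'M[R]_n) :
  spectral_radius M < 1 <->
  forall z, eigenvalue (map_mx toC M) z -> `|z| < 1.
Proof.
have [s [_ Ms]] := eigenvalue_seq M; rewrite /spectral_radius.
set E := (X in sup X).
have EM : ubound E (\big[Num.max/0]_(z <- s) complex.Re `|z|).
  by move=> _ [z /= + <-]; rewrite Ms => zs; apply: le_bigmax_seq.
split=> [ltE z Mz|lt1].
  rewrite -Re_normK -(rmorph1 toC) ltcR; apply: le_lt_trans ltE.
  apply: ub_le_sup; last by exists z.
  by exists (\big[Num.max/0]_(m <- s) complex.Re `|m|).
(* When [n = 0] there is no eigenvalue, and the supremum of the empty set is 0. *)
have [->|/set0P E0] := eqVneq E set0; first by rewrite sup0.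
apply: le_lt_trans (ge_sup E0 EM) _; rewrite big_seq bigmax_lt // => z zs.
by rewrite -ltcR Re_normK; apply: lt1; rewrite Ms.
Qed.

(** For [1 <= |z|] and a root [m], [|z - m| >= |z| - |m| >= (1 - |m|) |z|]; [c] is the product of
    the gaps [1 - |m|]. *)
Lemma char_poly_lower_bound n (M : 'M[R]_n) : spectral_radius M < 1 ->
  exists2 c : R, 0 < c & forall z : R[i], 1 <= `|z| ->
    toC c * `|z| ^+ n <= `|(char_poly (map_mx toC M)).[z]|.
Proof.
move=> /spectral_radius_lt1P; have [s [sM Ms]] := eigenvalue_seq M => lt1.
have Es : size s = n.
  have := congr1 (fun q : {poly _} => size q) sM.
  by rewrite size_char_poly (size_prod_XsubC s id) => -[].
exists (\prod_(m <- s) (1 - complex.Re `|m|)).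
  rewrite big_seq; apply: prodr_gt0 => m; rewrite -Ms => /lt1.
  by rewrite subr_gt0 -Re_normK -(rmorph1 toC) ltcR.
move=> z z1; rewrite sM horner_prod normr_prod -Es.
have -> : toC (\prod_(m <- s) (1 - complex.Re `|m|)) * `|z| ^+ size s =
    \prod_(m <- s) ((1 - `|m|) * `|z|).
  rewrite rmorph_prod big_split; congr (_ * _).
    by apply: eq_bigr => m _; rewrite -[in RHS]Re_normK -(rmorph1 toC) -rmorphB.
  by rewrite big_const_seq count_predT iter_mulr_1.
rewrite big_seq [leRHS]big_seq; apply: ler_prod => m; rewrite -Ms => /lt1 m1.
rewrite hornerXsubC; apply/andP; split.
  by rewrite mulr_ge0 // subr_ge0 ltW.
apply: le_trans (lerB_dist _ _); rewrite mulrBl mul1r lerB //.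
by rewrite ler_peMr.
Qed.

(** The scalar ['X] stands for the perturbation size [t]: each coefficient of the perturbed
    characteristic polynomial is thereby a polynomial, hence continuous, function of [t]. *)
Definition char_poly_pencil n (M D : 'M[R]_n) : {poly {poly R}} :=
  char_poly (map_mx polyC M + 'X *: map_mx polyC D).

Lemma char_poly_pencilE n (M D : 'M[R]_n) t k :
  ((char_poly_pencil M D)`_k).[t] = (char_poly (M + t *: D))`_k.
Proof.
rewrite -/(horner_eval t _) -coef_map map_char_poly.
congr ((char_poly _)`_k); apply/matrixP => i j.
by rewrite !mxE /= /horner_eval !hornerE.
Qed.

(* On [1 <= |z|] the characteristic polynomial of [M] is at least [c |z|^n],
   whereas perturbing [M] changes it by at most [g t |z|^n], both polynomials
   being monic of degree [n]; so no root of modulus at least 1 can appear. *)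
Lemma spectral_radius_lt1_near n (M D : 'M[R]_n) : spectral_radius M < 1 ->
  \forall t \near (0 : R), spectral_radius (M + t *: D) < 1.
Proof.
move=> /char_poly_lower_bound[c c0 cM].
pose a t k := (char_poly (M + t *: D))`_k.
pose g t := \sum_(k < n) `|a 0 k - a t k|.
have g_cvg : g t @[t --> (0 : R)] --> g 0.
  apply: cvg_big => [|k _]; first exact: add_continuous.
  apply: cvg_norm; apply: cvgB; first exact: cvg_cst.
  rewrite /a; under eq_fun do rewrite -char_poly_pencilE.
  rewrite -char_poly_pencilE; exact: continuous_horner.
have g0 : g 0 = 0 by apply: big1 => k _; rewrite subrr normr0.
rewrite g0 in g_cvg; near=> t.
have gt : g t < c by near: t; apply: cvgr_lt g_cvg _ c0.
apply/spectral_radius_lt1P => z; rewrite eigenvalue_root_char.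
rewrite -map_char_poly => /rootP zt; rewrite real_ltNge ?normr_real ?real1 //.
apply/negP => z1; have := cM z z1; apply/negP.
rewrite -real_ltNge ?normr_real ?realM ?realX ?normr_real //; last first.
  by apply/complex_realP; exists c.
have z0 : 0 < `|z| ^+ n by rewrite exprn_gt0 // (lt_le_trans ltr01).
apply: (@le_lt_trans _ _ (toC (g t) * `|z| ^+ n)); last first.
  by rewrite ltr_pM2r // ltcR.
(* Since [z] is a root of the perturbed polynomial, subtracting that polynomial's value at [z]
   changes nothing and leaves only coefficient differences. *)
rewrite -[X in `|X|]subr0 -{1}zt -map_char_poly !horner_coef.
rewrite !size_map_poly !size_char_poly -sumrB big_ord_recr /=.
have an t' : a t' n = 1.
  have /monicP := char_poly_monic (M + t' *: D).
  by rewrite lead_coefE size_char_poly.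
have aM k : (char_poly M)`_k = a 0 k by rewrite /a scale0r addr0.
rewrite !coef_map /= aM -/(a t n) !an subrr addr0.
have -> : toC (g t) = \sum_(k < n) toC `|a 0 k - a t k| by rewrite rmorph_sum.
rewrite mulr_suml; apply: le_trans (ler_norm_sum _ _ _) _.
apply: ler_sum => k _; rewrite !coef_map /= aM -mulrBl normrM normrX.
rewrite -rmorphB /= normc_def /= expr0n addr0 sqrtr_sqr ler_wpM2l ?ler0c //.
by rewrite ler_weXn2l // ltnW.
Unshelve. all: by end_near. Qed.

End SpectralRadius.

(** * Solvability of the discrete Lyapunov equation *)

Section StableLyapunov.
Context {R : realType}.
Local Notation toC := (real_complex R).

(* [X |-> X - A X A^T] is injective, hence bijective: a nonzero kernel element
   would make both [z] and [z^-1] eigenvalues of [A]. *)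
Lemma dlyapE n (A W : 'M[R]_n) : spectral_radius A < 1 ->
  dlyap A W = W + A *m dlyap A W *m A^T.
Proof.
move=> /spectral_radius_lt1P lt1.
pose L : {linear 'M[R]_n -> 'M[R]_n} := idfun \- (mulmxr A^T \o mulmx A).
have LE X : L X = X - A *m X *m A^T by [].
have Lunit : lin_mx L \in unitmx.
  rewrite -row_free_unit -kermx_eq0; apply/rowV0P => u /sub_kermxP.
  rewrite -[u]vec_mxK mul_vec_lin => /(canRL mxvecK); rewrite linear0 LE.
  move: (vec_mx u) => X /eqP; rewrite subr_eq0 => /eqP AXA.
  have [->|X0] := eqVneq X 0; first by rewrite linear0.
  have XC0 : map_mx toC X != 0 by rewrite map_mx_eq0.
  have AXAC : map_mx toC A *m map_mx toC X *m (map_mx toC A)^T = map_mx toC X.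
    by rewrite map_trmx -!map_mxM -AXA.
  have [z [z0 /lt1 z1 /lt1]] := stein_eigenvalue XC0 AXAC.
  rewrite normfV invf_lt1 ?normr_gt0 // => /(lt_trans z1).
  by rewrite ltxx.
(* [dlyap] falls back to 0 only if no solution exists; the preimage of [W] under [L] is one. *)
apply: (@xgetPex _ 0 [set X | X = W + A *m X *m A^T]).
exists (vec_mx (mxvec W *m invmx (lin_mx L))) => /=; set X := vec_mx _.
have : L X = W.
  by apply: (can_inj mxvecK); rewrite -mul_vec_lin vec_mxK mulmxKV.
by rewrite LE => <-; rewrite subrK.
Qed.

End StableLyapunov.

(** * Vectorization and the squared Frobenius norm *)

Section Vectorization.
Context {R : realType}.

Lemma vecD m n (X Y : 'M[R]_(m, n)) : vec (X + Y) = vec X + vec Y.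
Proof. by apply/colP => k; rewrite !mxE. Qed.

Lemma vecB m n (X Y : 'M[R]_(m, n)) : vec (X - Y) = vec X - vec Y.
Proof. by apply/colP => k; rewrite !mxE. Qed.

(** Turns the Lyapunov equation and the gradient formula into linear relations in the vectorized
    covariance. *)
Lemma vec_mulmx m n k q (M1 : 'M[R]_(m, n)) (X : 'M[R]_(n, k))
    (M2 : 'M[R]_(q, k)) :
  vec (M1 *m X *m M2^T) = tensmx M2 M1 *m vec X.
Proof.
apply/colP => a; case: (mxtens_indexP a) => i j.
rewrite mxE mxtens_indexK !mxE /=.
under eq_bigr do rewrite !mxE mulr_suml.
rewrite pair_big /= [RHS](reindex (@mxtens_index _ _)) /=; last first.
  exists (@mxtens_unindex _ _) => x _; first exact: mxtens_indexK.
  exact: mxtens_unindexK.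
apply: eq_bigr => -[c e] _.
by rewrite tensmxE mxE mxtens_indexK /= mulrC mulrA.
Qed.

Definition frobenius_sq m n (X : 'M[R]_(m, n)) : R := \sum_i \sum_j X i j ^+ 2.

Lemma frobenius_sq_ge0 m n (X : 'M[R]_(m, n)) : 0 <= frobenius_sq X.
Proof. by do 2!apply: sumr_ge0 => ? _; exact: sqr_ge0. Qed.

Lemma sqr_frobenius_norm m n (X : 'M[R]_(m, n)) :
  frobenius_norm X ^+ 2 = frobenius_sq X.
Proof. by rewrite sqr_sqrtr // frobenius_sq_ge0. Qed.

Lemma frobenius_sq_eq0 m n (X : 'M[R]_(m, n)) : frobenius_sq X <= 0 -> X = 0.
Proof.
move=> X_le0; have /eqP : frobenius_sq X == 0.
  by rewrite eq_le X_le0 frobenius_sq_ge0.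
move=> /psumr_eq0P X0; apply/matrixP => i j.
have /psumr_eq0P Xi0 := X0 (fun i _ => sumr_ge0 _ (fun j _ => sqr_ge0 _)) i isT.
have /eqP := Xi0 (fun j _ => sqr_ge0 _) j isT.
by rewrite sqrf_eq0 mxE => /eqP.
Qed.

Lemma mxtrace_trmx_mul m n (X Y : 'M[R]_(m, n)) :
  \tr (X^T *m Y) = \sum_i \sum_j X i j * Y i j.
Proof.
rewrite exchange_big; apply: eq_bigr => j _.
by rewrite mxE; apply: eq_bigr => i _; rewrite mxE.
Qed.

Lemma vec_sqr m n (X : 'M[R]_(m, n)) :
  ((vec X)^T *m vec X) 0 0 = frobenius_sq X.
Proof.
rewrite mxE /frobenius_sq exchange_big pair_big /=.
rewrite [LHS](reindex (@mxtens_index _ _)) /=; last first.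
  exists (@mxtens_unindex _ _) => x _; first exact: mxtens_indexK.
  exact: mxtens_unindexK.
by apply: eq_bigr => -[c e] _; rewrite !mxE mxtens_indexK expr2.
Qed.

End Vectorization.

(** * Quadratic forms and the bisimulation certificate *)

Section BisimulationBound.
Context {R : realType}.

Lemma quadB n (M1 M2 : 'M[R]_n) x : quad (M1 - M2) x = quad M1 x - quad M2 x.
Proof. by rewrite /quad mulmxBr mulmxBl !mxE. Qed.

Lemma quadN n (M : 'M[R]_n) x : quad (- M) x = - quad M x.
Proof. by rewrite /quad mulmxN mulNmx !mxE. Qed.

Lemma quadZ n a (M : 'M[R]_n) x : quad (a *: M) x = a * quad M x.
Proof. by rewrite /quad -scalemxAr -scalemxAl !mxE. Qed.

Lemma quad_congr n q (F : 'M[R]_(q, n)) (M : 'M[R]_q) x :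
  quad (F^T *m M *m F) x = quad M (F *m x).
Proof. by rewrite /quad trmx_mul !mulmxA. Qed.

Lemma quad_gram n q (C : 'M[R]_(q, n)) x :
  quad (C^T *m C) x = ((C *m x)^T *m (C *m x)) 0 0.
Proof. by rewrite /quad trmx_mul !mulmxA. Qed.

Lemma quad_lincomb n (M : 'M[R]_n) x y t : M^T = M ->
  quad M (x + t *: y) =
  quad M x + 2 * t * (x^T *m M *m y) 0 0 + t ^+ 2 * quad M y.
Proof.
move=> Msym; rewrite /quad; have yx : (y^T *m M *m x) 0 0 = (x^T *m M *m y) 0 0.
  rewrite -[in RHS](trmxK (x^T *m M *m y)) [RHS]mxE.
  by rewrite !trmx_mul trmxK Msym mulmxA.
have -> : (x + t *: y)^T = x^T + t *: y^T by rewrite linearD linearZ.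
rewrite !mulmxDl !mulmxDr -!scalemxAl -!scalemxAr.
move: yx; rewrite !mxE => ->; ring.
Qed.

(** Expanding [0 <= e^-1 * quad M (x - e *: y)] bounds the cross term. *)
Lemma quad_young n (M : 'M[R]_n) x y e : psd M -> 0 < e ->
  quad M (x + y) <= (1 + e^-1) * quad M x + (1 + e) * quad M y.
Proof.
move=> [Msym M_ge0] e0.
have := quad_lincomb x y 1 Msym; rewrite scale1r => ->.
have := M_ge0 (x + (- e) *: y); rewrite quad_lincomb //.
set b := (_ *m _) 0 0; set qx := quad M x; set qy := quad M y => H.
have : 0 <= e^-1 * (qx + 2 * - e * b + (- e) ^+ 2 * qy).
  by apply: mulr_ge0 => //; rewrite invr_ge0 ltW.
have -> : e^-1 * (qx + 2 * - e * b + (- e) ^+ 2 * qy) =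
   e^-1 * qx - 2 * b + e * qy by field; rewrite gt_eqF.
lra.
Qed.

Lemma eta_of_gt0 (lam : R) : 0 < lam < 1 -> 0 < eta_of lam.
Proof.
move=> /andP[lam0 lam1]; rewrite subr_gt0 invf_gt1 ?sqrtr_gt0 ?subr_gt0 //.
by rewrite -[ltRHS]sqrtr1 ltr_sqrt // gtrBl.
Qed.

(* With [s = Num.sqrt (1 - lam)], the denominator of [bisim_obj] is [1 - s]. *)
Lemma bisim_obj_denom_gt0 (lam : R) : 0 < lam < 1 ->
  0 < lam - eta_of lam * (1 - lam).
Proof.
move=> /andP[lam0 lam1]; have s0 : 0 < Num.sqrt (1 - lam).
  by rewrite sqrtr_gt0 subr_gt0.
rewrite /eta_of -[in X in _ * X](@sqr_sqrtr _ (1 - lam)) ?subr_ge0 ?ltW //.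
have : Num.sqrt (1 - lam) < 1 by rewrite -[ltRHS]sqrtr1 ltr_sqrt // gtrBl.
have := @sqr_sqrtr _ (1 - lam); rewrite subr_ge0 ltW // => /(_ isT).
move: (Num.sqrt _) s0 => s s0 sE s1.
have -> : (s^-1 - 1) * s ^+ 2 = s - s ^+ 2 by field; rewrite gt_eqF.
lra.
Qed.

(** Write [q] for [quad M]. Young's inequality and the decrease [q (F x) <= (1 - lam) q x] give [q x
    <= (1 + e^-1) q nu + (1 + e) (1 - lam) q x]. Solving for [q x] leaves the factor [1 - (1 + e) (1
    - lam) = lam - e (1 - lam)], the denominator of [bisim_obj]. *)
Lemma bisim_bound n q (F : 'M[R]_n) (C : 'M[R]_(q, n)) nu M lam x :
  bisim_feasible F C M lam -> x = nu + F *m x ->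
  ((C *m x)^T *m (C *m x)) 0 0 <= bisim_obj nu M lam.
Proof.
move=> [Mpsd lam01 [_ CM] [_ FM]] xE.
have := CM x; rewrite quadB quad_gram subr_ge0 => /le_trans; apply.
rewrite /bisim_obj ler_pdivlMr ?bisim_obj_denom_gt0 //.
have e0 := eta_of_gt0 lam01.
have := quad_young nu (F *m x) Mpsd e0; rewrite -xE.
have := FM x; rewrite quadB quadN quadZ quadB quad_congr.
move: (eta_of lam) e0 => e e0 FMx.
have : (1 + e) * quad M (F *m x) <= (1 + e) * ((1 - lam) * quad M x).
  by rewrite ler_wpM2l; lra.
lra.
Qed.

End BisimulationBound.

(** * First-order optimality *)

Section FirstOrder.
Context {R : realType}.

Lemma directional_min_ge0 (V : normedModType R) (f : V -> R) (x h : V) d :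
  is_derive x h f d ->
  (\forall t \near (0 : R), f x <= f (t *: h + x)) -> 0 <= d.
Proof.
move=> [fx <-] fmin.
have : t^-1 *: (f (t *: h + x) - f x) @[t --> (0 : R)^'+] --> 'D_h f x.
  exact: cvg_dnbhs_at_right.
move/cvgr_to_ge; apply; near=> t; rewrite mulr_ge0 ?invr_ge0 // subr_ge0.
by near: t; exact: (cvg_within _ fmin).
Unshelve. all: by end_near. Qed.

(** Along the descent direction [- \sum_i G i] the derivative is minus the squared norm of
    [\sum_i G i], yet it is nonnegative at a minimum. Minimality is asked line by line, the form in
    which openness of the stability sets is proved. *)
Lemma sum_grad_eq0 N m n (f : 'I_N -> 'M[R]_(m, n) -> R)
    (G : 'I_N -> 'M[R]_(m, n)) (K : 'M[R]_(m, n)) :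
  (forall i, is_diff K (f i) (fun H => \tr ((G i)^T *m H))) ->
  (forall H, \forall t \near (0 : R),
     \sum_i f i K <= \sum_i f i (t *: H + K)) ->
  \sum_i G i = 0.
Proof.
move=> fdiff fmin; pose H := - \sum_i G i.
have dsum : is_derive K H (\sum_i f i) (\sum_i \tr ((G i)^T *m H)).
  apply: is_derive_sum => i; have [fK dfE] := fdiff i.
  by split; [exact: diff_derivable|rewrite deriveE // dfE].
have : 0 <= \sum_i \tr ((G i)^T *m H).
  apply: (directional_min_ge0 dsum).
  by apply: filterS (fmin H) => t; rewrite !fct_sumE.
have -> : \sum_i \tr ((G i)^T *m H) = - frobenius_sq (\sum_i G i).
  rewrite -raddf_sum -mulmx_suml -raddf_sum /= mulmxN raddfN /=.
  rewrite mxtrace_trmx_mul.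
  by congr (- _); apply: eq_bigr => k _; apply: eq_bigr => l _; rewrite expr2.
by rewrite oppr_ge0 => /frobenius_sq_eq0.
Qed.

End FirstOrder.

(** * Families with zero sum and their mutual distances *)

Section Averaging.
Context {R : realType}.

(** The other terms sum to [- g i], so the cross terms of the expanded squares contribute
    [2 * g i ^+ 2], which is nonnegative. *)
Lemma sqr_le_mean_sqr_dist (I : finType) (g : I -> R) i : \sum_j g j = 0 ->
  g i ^+ 2 <= (#|I|%:R - 1)^-1 * \sum_(j | j != i) (g i - g j) ^+ 2.
Proof.
move=> g0; have {g0} gi : \sum_(j | j != i) g j = - g i.
  by apply/eqP; rewrite -addr_eq0 addrC; move: g0; rewrite (bigD1 i) //= => ->.
have cardI : #|[pred j | j != i]|%:R = #|I|%:R - 1 :> R.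
  have I0 : (0 < #|I|)%N by apply/card_gt0P; exists i.
  by rewrite (eq_card (B := predC1 i)) // cardC1 -subn1 natrB.
(* For a single index the inverse of 0 is 0, so the right side vanishes; the zero sum forces
   [g i = 0]. *)
have [I1|I1] := eqVneq (#|I|%:R - 1 : R) 0.
  rewrite I1 invr0 mul0r; move: gi; rewrite big_pred0.
    by move/eqP; rewrite eq_sym oppr_eq0 => /eqP ->; rewrite expr0n.
  have : #|[pred j | j != i]| = 0%N.
    by apply/eqP; rewrite -(pnatr_eq0 R) cardI I1.
  by move=> /card0_eq.
rewrite mulrC ler_pdivlMr; last by rewrite lt_def I1 -cardI ler0n.
have -> : \sum_(j | j != i) (g i - g j) ^+ 2 =
    \sum_(j | j != i) (g i ^+ 2 + - 2 * g i * g j + g j ^+ 2).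
  by apply: eq_bigr => j _; ring.
have cst : \sum_(j | j != i) g i ^+ 2 = g i ^+ 2 * (#|I|%:R - 1).
  by rewrite -cardI mulr_natr -sumr_const.
rewrite !big_split /= cst -mulr_sumr gi.
have : 0 <= \sum_(j | j != i) g j ^+ 2.
  by apply: sumr_ge0 => j _; exact: sqr_ge0.
have := sqr_ge0 (g i); lra.
Qed.

Lemma frobenius_sq_le_mean_dist N m n (G : 'I_N -> 'M[R]_(m, n)) i :
  \sum_j G j = 0 ->
  frobenius_sq (G i) <=
  (N%:R - 1)^-1 * \sum_(j | j != i) frobenius_sq (G i - G j).
Proof.
move=> G0; rewrite /frobenius_sq.
rewrite [in leRHS]exchange_big mulr_sumr; apply: ler_sum => k _.
rewrite [in leRHS]exchange_big mulr_sumr; apply: ler_sum => l _.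
under [in leRHS]eq_bigr do rewrite !mxE.
have := @sqr_le_mean_sqr_dist _ (fun j => G j k l) i; rewrite card_ord; apply.
by have := congr1 (fun X : 'M[R]_(m, n) => X k l) G0; rewrite summxE mxE.
Qed.

End Averaging.

(** * Stability and gradients of lifted controllers *)

Section LiftedTask.
Context {R : realType} {nx nu ny p : nat}.
Local Notation lifted := 'M[R]_(nu, p * nu + p * ny).

(** [A_cl] is affine in [K]: a step along [H] perturbs it along [lqgB tk *m gain_of S H]. *)
Lemma stable_set_near (tk : lqg_task R nx nu ny)
    (S : 'M[R]_(nx, p * nu + p * ny)) (K H : lifted) :
  stable_set tk S K -> \forall t \near (0 : R), stable_set tk S (t *: H + K).
Proof.
move=> /(spectral_radius_lt1_near (lqgB tk *m gain_of S H)).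
apply: filterS => t; rewrite /stable_set /=; congr (spectral_radius _ < 1).
by rewrite /A_cl /gain_of mulmxDl mulmxDr -scalemxAl -scalemxAr addrCA addrC.
Qed.

Lemma Sigma_KE (tk : lqg_task R nx nu ny) (S : 'M[R]_(nx, p * nu + p * ny))
    (K : lifted) : stable_set tk S K ->
  vec (Sigma_K tk S K) = nu_vec tk + F_K tk S K *m vec (Sigma_K tk S K).
Proof. by move=> /dlyapE Sig; rewrite -vec_mulmx -vecD -Sig. Qed.

Lemma vec_grad_formula (tk : lqg_task R nx nu ny)
    (S : 'M[R]_(nx, p * nu + p * ny)) (K : lifted) :
  vec (grad_formula tk S K) = C_K tk S K *m vec (Sigma_K tk S K).
Proof. exact: vec_mulmx. Qed.

(** The stacked covariances solve the fixed-point equation of the block-diagonal [F_pair], and the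
    minus sign in [C_pair] turns them into the gradient difference. *)
Lemma grad_dist_le_bisim N (tk : 'I_N -> lqg_task R nx nu ny)
    (S : 'I_N -> 'M[R]_(nx, p * nu + p * ny)) i j (K : lifted) M lam :
  stable_set (tk i) (S i) K -> stable_set (tk j) (S j) K ->
  bisim_feasible (F_pair tk S i j K) (C_pair tk S i j K) M lam ->
  frobenius_sq (grad_formula (tk i) (S i) K - grad_formula (tk j) (S j) K) <=
  bisim_obj (nu_pair tk i j) M lam.
Proof.
move=> iK jK /bisim_bound bound.
pose x := col_mx (vec (Sigma_K (tk i) (S i) K)) (vec (Sigma_K (tk j) (S j) K)).
rewrite -vec_sqr vecB !vec_grad_formula.
suff -> : C_K (tk i) (S i) K *m vec (Sigma_K (tk i) (S i) K) -
    C_K (tk j) (S j) K *m vec (Sigma_K (tk j) (S j) K) = C_pair tk S i j K *m x.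
  apply: bound.
  by rewrite mul_block_col !mul0mx addr0 add0r add_col_mx -!Sigma_KE.
by rewrite mul_row_col mulNmx.
Qed.

End LiftedTask.

Theorem theoremV1 (R : realType) (nx nu ny p N : nat)
  (d : measure_display) (T : measurableType d) (P : probability T R)
  (tk : 'I_N -> lqg_task R nx nu ny)
  (w : 'I_N -> nat -> T -> 'cV[R]_nx) (v : 'I_N -> nat -> T -> 'cV[R]_ny)
  (S : 'I_N -> 'M[R]_(nx, p * nu + p * ny))
  (Kopt : 'I_N -> 'M[R]_(nu, p * nu + p * ny))
  (K0 : 'M[R]_(nu, p * nu + p * ny)) (beta : 'I_N -> R)
  (M : 'I_N -> 'I_N -> 'M[R]_(nu, p * nu + p * ny) ->
       'M[R]_(nx * nx + nx * nx))
  (lam : 'I_N -> 'I_N -> 'M[R]_(nu, p * nu + p * ny) -> R)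
  (Kst : 'M[R]_(nu, p * nu + p * ny)) :
  let J i := cost (tk i) (S i) P (w i) (v i) in
  let Kset i := stable_set (tk i) (S i) in
  let KsetS := \bigcap_(i in [set: 'I_N]) Kset i in
  let Kstab i :=
    stab_sublevel (tk i) (S i) P (w i) (v i) (Kopt i) K0 (beta i) in
  let KstabS := \bigcap_(i in [set: 'I_N]) Kstab i in
  let Jhat K := N%:R^-1 * \sum_(i < N) J i K in
  (forall i, wf_task (tk i)) ->
  lqg_noise P tk w v ->
  (forall i, Kset i (Kopt i) /\
             forall K, Kset i K -> J i (Kopt i) <= J i K) ->
  (forall i t, {ae P, forall om,
     let K := gain_of (S i) (Kopt i) in
     estimate (tk i) K ((w i)^~ om) ((v i)^~ om) t =
     S i *m history (tk i) K ((w i)^~ om) ((v i)^~ om) p t}) ->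
  KsetS K0 ->
  (forall i, 1 <= beta i) ->
  (forall i K, Kset i K ->
     is_diff K (J i)
       (fun H => \tr ((grad_formula (tk i) (S i) K)^T *m H))) ->
  (forall i, 0 < gamma (tk i) (S i) (Kopt i) /\
     forall K, Kstab i K ->
       J i K - J i (Kopt i) <=
       (gamma (tk i) (S i) (Kopt i))^-1 *
       frobenius_norm (grad_formula (tk i) (S i) K) ^+ 2) ->
  (forall i j K, KstabS K -> i != j ->
     bisim_minimizer (F_pair tk S i j K) (C_pair tk S i j K)
       (nu_pair tk i j) (M i j K) (lam i j K)) ->
  KstabS Kst ->
  (forall K, KsetS K -> Jhat Kst <= Jhat K) ->
  forall i : 'I_N,
    J i Kst - J i (Kopt i) <=
    spectral_norm (S i) * spectral_norm (Sigma_K (tk i) (S i) (Kopt i)) *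
      b_task tk M lam i Kst /
    (4 * lambda_min (Sigma_nu (tk i)) ^+ 2 * lambda_min (lqgR (tk i))).
Proof.
move=> J Kset KsetS Kstab KstabS Jhat _ _ _ _ _ _ Jdiff Jdom Jbisim Kst_stab
  Kst_min i.
have KstK j : Kset j Kst by have [] := Kst_stab j I.
pose G j := grad_formula (tk j) (S j) Kst.
have G0 : \sum_j G j = 0.
  apply: (@sum_grad_eq0 _ _ _ _ J G Kst) => [j|H].
    exact: Jdiff (KstK j).
  (* There are finitely many tasks, so points near [Kst] on the line are stable for all of them at
     once and compete with [Kst]. *)
  have : \forall t \near (0 : R), forall j, Kset j (t *: H + Kst).
    exact: (filter_forall _ (fun j => stable_set_near H (KstK j))).
  apply: filterS => t tK; have := Kst_min _ (fun j _ => tK j).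
  rewrite ler_pM2l // invr_gt0 ltr0n; exact: leq_ltn_trans (ltn_ord i).
have [gam_gt0 dom] := Jdom i.
apply: le_trans (dom Kst (Kst_stab i I)) _; rewrite sqr_frobenius_norm.
have -> : spectral_norm (S i) * spectral_norm (Sigma_K (tk i) (S i) (Kopt i)) *
      b_task tk M lam i Kst /
    (4 * lambda_min (Sigma_nu (tk i)) ^+ 2 * lambda_min (lqgR (tk i))) =
    (gamma (tk i) (S i) (Kopt i))^-1 * b_task tk M lam i Kst.
  rewrite /gamma invf_div; ring.
rewrite ler_wpM2l ?invr_ge0 ?(ltW gam_gt0) //.
apply: le_trans (frobenius_sq_le_mean_dist i G0) _.
(* The index [i] forces [1 <= N]; for [N = 1] the averaging factor is the inverse of 0, that is 0,
   which is still nonnegative. *)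
have N_ge1 : 0 <= (N%:R - 1 : R).
  by rewrite subr_ge0 ler1n (leq_ltn_trans _ (ltn_ord i)).
rewrite ler_wpM2l ?invr_ge0 //; apply: ler_sum => j ji.
have [feas _] : bisim_minimizer (F_pair tk S i j Kst) (C_pair tk S i j Kst)
    (nu_pair tk i j) (M i j Kst) (lam i j Kst).
  by apply: Jbisim; rewrite // eq_sym.
exact: grad_dist_le_bisim (KstK i) (KstK j) feas.
Qed.
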